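(* Let $n\geqslant 1$. Every commutative $n$-valued monoid of order $3$, on a set $X=\{e,x_1,x_2\}$ with unit $e$, belongs to one of the four series $B_1,B_2,B_3,B_4$. Every noncommutative $n$-valued monoid of order $3$ is a diagonal of one of the two noncommutative single-valued monoids on $\{e,1,2\}$ (with unit $e$) given by the multiplication tables $$1\ast1=1,\quad 1\ast2=1,\quad 2\ast1=2,\quad 2\ast2=2$$ and $$1\ast1=1,\quad 1\ast2=2,\quad 2\ast1=1,\quad 2\ast2=2 .$$ In particular, all $n$-valued groups of order $3$ are commutative, and there exist only two noncommutative multivalued monoids of order $3$ up to isomorphism.
   Context: $\mathrm{Sym}^n(X)=X^{n}/S_n$ is the set of $n$-element multisets of elements of $X$; a multiset is written as a formal sum $\sum_{x\in X} m_x\, x$ with non-negative integer multiplicities summing to $n$. An $n$-valued monoid is a set $X$ with an operation $\ast:X\times X\to \mathrm{Sym}^n(X)$ such that: (associativity) for all $x,y,z\in X$ the $n^2$-multisets $[x\ast w\mid w\in y\ast z]$ and $[w\ast z\mid w\in x\ast y]$ coincide (with $w$ running with multiplicity); (unit) there is $e\in X$ with $e\ast x=x\ast e=[x,\dots,x]$ ($n$ times) for every $x\in X$. Its order is $|X|$. It is commutative if $x\ast y=y\ast x$ for all $x,y$. An $n$-valued group is an $n$-valued monoid equipped with a map $\mathrm{inv}:X\to X$ such that $e\in x\ast \mathrm{inv}(x)$ and $e\in \mathrm{inv}(x)\ast x$ for every $x\in X$. A multivalued monoid is an $n$-valued monoid for some $n\ge1$; single-valued means $n=1$, i.e. an ordinary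 monoid. Diagonal: from an $n$-valued monoid with multiplication $\mu$ on $X$ and a natural number $m$ one obtains an $mn$-valued monoid on the same set with multiplication $X\times X\xrightarrow{\mu}\mathrm{Sym}^nX\to\mathrm{Sym}^{mn}X$, where the last map multiplies all multiplicities by $m$. An $n$-valued monoid $X$ is isomorphic to an $n'$-valued monoid $X'$ if there is a bijection $\phi:X\to X'$ with $\phi(e)=e'$ and $m^{z}_{x,y}/n=m^{\phi(z)}_{\phi(x),\phi(y)}/n'$ for all $x,y,z\in X$, where $m^z_{x,y}$ is the multiplicity of $z$ in $x\ast y$. An $n$-valued monoid structure on $X=\{e,x_1,x_2\}$ with unit $e$ is given by the $4\times3$ matrix $B$ whose rows list, in order, the multiplicities of $(e,x_1,x_2)$ in $x_1\ast x_1$, $x_1\ast x_2$, $x_2\ast x_1$, $x_2\ast x_2$. It belongs to the series $B_j$ if its matrix has the form $B_j$ below for some values of the parameters $a_0,a_1,b_0,b_1,c_0,c_1$, with all entries non-negative integers and all denominators nonzero: $$B_1=\begin{pmatrix} a_0 & n-a_0 & 0\\ 0&0&n\\ 0&0&n\\ c_0 & \frac{c_0n}{a_0} & n-c_0-\frac{c_0n}{a_0}\end{pmatrix},$$ $$B_2=\begin{pmatrix} a_0&a_1&n-a_0-a_1\\ b_0&b_1&n-b_0-b_1\\ b_0&b_1&n-b_0-b_1\\ \frac{b_0(n-b_0-b_1)+a_0b_1-a_1b_0}{n-a_0-a_1} & \frac{(b_0+b_1)(n-b_1)}{n-a_0-a_1} & \frac{(n-b_0-b_1)^2+n(b_1-a_0-a_1)+a_1b_0-a_0b_1}{n-a_0-a_1}\end{pmatrix},$$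 $$B_3=\begin{pmatrix}0&n&0\\0&n&0\\0&n&0\\c_0&c_1&n-c_0-c_1\end{pmatrix},\qquad B_4=\begin{pmatrix}0&n&0\\0&0&n\\0&0&n\\0&c_1&n-c_1\end{pmatrix}.$$ *)

(* Defs.v *)
From HB Require Import structures.
From mathcomp Require Import all_boot all_order all_algebra.
From mathcomp Require Import finmap multiset.

Set Implicit Arguments.
Unset Strict Implicit.
Unset Printing Implicit Defensive.

Import Order.TTheory GRing.Theory Num.Theory.

Local Open Scope mset_scope.
Local Open Scope nat_scope.

Record Symn (n : nat) (X : choiceType) := SymMset {
  sym_mset :> {mset X};
  sym_mset_size : size sym_mset == n
}.

HB.instance Definition _ n X := [isSub of @Symn n X for @sym_mset n X].
HB.instance Definition _ n X := [Choice of @Symn n X by <:].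

HB.instance Definition _ (X : choiceType) :=
  Monoid.isComLaw.Build {mset X} mset0 (@msetD X)
    (@msetDA X) (@msetDC X) (@mset0D X).

(* The constraint 1 <= n is not part of the structure; it is assumed where     *)
(* n-valued monoids are quantified over.                                       *)
(* The big operator is the multiset [x * w | w in y * z], w running over the   *)
(* enumeration of y * z with multiplicity.                                     *)
Record nvmonoid (n : nat) (X : choiceType) := NVMonoid {
  nvmul : X -> X -> Symn n X;
  nvunit : X;
  nvmulA : forall x y z : X,
    \big[@msetD X/mset0]_(w <- nvmul y z) nvmul x w
    = \big[@msetD X/mset0]_(w <- nvmul x y) nvmul w z;
  nvmul1x : forall x : X, nvmul nvunit x = msetn n x :> {mset X};
  nvmulx1 : forall x : X, nvmul x nvunit = msetn n x :> {mset X}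
}.

Definition nvmult n X (M : nvmonoid n X) (x y z : X) : nat :=
  (nvmul M x y : {mset X}) z.

Definition nvcommutative n X (M : nvmonoid n X) : Prop :=
  forall x y : X, nvmul M x y = nvmul M y x.

Record nvgroup (n : nat) (X : choiceType) := NVGroup {
  nvgroup_monoid :> nvmonoid n X;
  nvinv : X -> X;
  nvmulxV : forall x : X,
    nvunit nvgroup_monoid \in (nvmul nvgroup_monoid x (nvinv x) : {mset X});
  nvmulVx : forall x : X,
    nvunit nvgroup_monoid \in (nvmul nvgroup_monoid (nvinv x) x : {mset X})
}.

Lemma bigmsetDE (X : choiceType) (I : Type) (s : seq I) (F : I -> {mset X}) u :
  (\big[@msetD X/mset0]_(i <- s) F i) u = \sum_(i <- s) F i u.
Proof.
elim: s => [|i s IHs]; first by rewrite !big_nil mset0E.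
by rewrite !big_cons msetE2 IHs.
Qed.

Section SingleValued.
Variables (X : choiceType) (op : X -> X -> X) (e : X).
Hypotheses (opA : associative op) (op1x : left_id e op) (opx1 : right_id e op).

Fact single_size x y : size ([mset op x y] : {mset X}) == 1.
Proof. by rewrite enum_msetn. Qed.

Let smul x y : Symn 1 X := SymMset (single_size x y).

Fact single_mulA x y z :
  \big[@msetD X/mset0]_(w <- smul y z) smul x w
  = \big[@msetD X/mset0]_(w <- smul x y) smul w z.
Proof. by rewrite /= !enum_msetn !big_seq1 /= opA. Qed.

Fact single_mul1x x : smul e x = msetn 1 x :> {mset X}.
Proof. by rewrite /= op1x. Qed.

Fact single_mulx1 x : smul x e = msetn 1 x :> {mset X}.
Proof. by rewrite /= opx1. Qed.

Definition single_valued : nvmonoid 1 X :=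
  NVMonoid single_mulA single_mul1x single_mulx1.

End SingleValued.

Fact mset_scale_key : unit. Proof. exact: tt. Qed.
Definition mset_scale (X : choiceType) (m : nat) (A : {mset X}) : {mset X} :=
  [mset[mset_scale_key] x in finsupp A => m * A x].

Section Diagonal.
Variable X : choiceType.

Lemma mset_scaleE m (A : {mset X}) x : mset_scale m A x = m * A x.
Proof. by rewrite fsfunE; case: finsuppP => // _; rewrite muln0. Qed.

Lemma perm_mset_scale m (A : {mset X}) :
  perm_eq (mset_scale m A) (flatten (nseq m (A : seq X))).
Proof.
apply/allP => x _ /=; rewrite count_mem_mset mset_scaleE count_flatten map_nseq.
by rewrite sumn_nseq count_mem_mset mulnC.
Qed.

Lemma big_mset_scale m (A : {mset X}) (F : X -> nat) :
  \sum_(w <- mset_scale m A) F w = m * \sum_(w <- (A : seq X)) F w.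
Proof.
rewrite (perm_big _ (perm_mset_scale m A)) /= big_flatten big_nseq.
by rewrite iter_addn_0 mulnC.
Qed.

Variables (m n : nat) (M : nvmonoid n X).

Fact diagonal_size x y : size (mset_scale m (nvmul M x y)) == m * n.
Proof.
rewrite -sum1_size big_mset_scale sum1_size.
by rewrite (eqP (sym_mset_size (nvmul M x y))).
Qed.

Let dmul x y : Symn (m * n) X := SymMset (diagonal_size x y).

Fact diagonal_mulA x y z :
  \big[@msetD X/mset0]_(w <- dmul y z) dmul x w
  = \big[@msetD X/mset0]_(w <- dmul x y) dmul w z.
Proof.
apply/msetP => u; rewrite !bigmsetDE /= !big_mset_scale; congr (_ * _).
under eq_bigr => w _ do rewrite mset_scaleE.
under [RHS]eq_bigr => w _ do rewrite mset_scaleE.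
by rewrite -!big_distrr -!bigmsetDE nvmulA.
Qed.

Fact scale_msetn x : mset_scale m (msetn n x) = msetn (m * n) x :> {mset X}.
Proof.
by apply/msetP => u; rewrite mset_scaleE !msetnE; case: eqP => // _; rewrite muln0.
Qed.

Fact diagonal_mul1x x : dmul (nvunit M) x = msetn (m * n) x :> {mset X}.
Proof. by rewrite /= nvmul1x scale_msetn. Qed.

Fact diagonal_mulx1 x : dmul x (nvunit M) = msetn (m * n) x :> {mset X}.
Proof. by rewrite /= nvmulx1 scale_msetn. Qed.

Definition diagonal : nvmonoid (m * n) X :=
  NVMonoid diagonal_mulA diagonal_mul1x diagonal_mulx1.

End Diagonal.

(* M is a diagonal of N, the carriers being identified through f.              *)
Definition diagonal_via n X (M : nvmonoid n X) k Y (N : nvmonoid k Y)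
    (f : Y -> X) : Prop :=
  [/\ bijective f, f (nvunit N) = nvunit M &
      exists2 m : nat, n = m * k &
        forall x y z : Y,
          nvmult M (f x) (f y) (f z) = nvmult (diagonal m N) x y z].

Definition nvisom n X (M : nvmonoid n X) n' X' (M' : nvmonoid n' X') : Prop :=
  exists phi : X -> X',
    [/\ bijective phi, phi (nvunit M) = nvunit M' &
        forall x y z : X,
          ((nvmult M x y z)%:Q / n%:Q)%R
          = ((nvmult M' (phi x) (phi y) (phi z))%:Q / n'%:Q)%R].

(* The two single-valued monoids live on 'I_3, the unit e being 0. In the      *)
(* tables the numerals 0, 1, 2 denote elements of 'I_3 (through its Z/3 ring   *)
(* structure, used for nothing else); row x, column y holds x * y.             *)
Definition table_op (t : seq (seq 'I_3)) (x y : 'I_3) : 'I_3 :=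
  nth ord0 (nth [::] t x) y.

Definition left_table : seq (seq 'I_3) :=
  [:: [:: 0; 1; 2]; [:: 1; 1; 1]; [:: 2; 2; 2]]%R.

Definition right_table : seq (seq 'I_3) :=
  [:: [:: 0; 1; 2]; [:: 1; 1; 2]; [:: 2; 1; 2]]%R.

Fact left_opA : associative (table_op left_table).
Proof.
by move=> [[|[|[|?]]] ?] [[|[|[|?]]] ?] [[|[|[|?]]] ?] //; apply/val_inj.
Qed.

Fact left_op1x : left_id ord0 (table_op left_table).
Proof. by move=> [[|[|[|?]]] ?] //; apply/val_inj. Qed.

Fact left_opx1 : right_id ord0 (table_op left_table).
Proof. by move=> [[|[|[|?]]] ?] //; apply/val_inj. Qed.

Fact right_opA : associative (table_op right_table).
Proof.
by move=> [[|[|[|?]]] ?] [[|[|[|?]]] ?] [[|[|[|?]]] ?] //; apply/val_inj.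
Qed.

Fact right_op1x : left_id ord0 (table_op right_table).
Proof. by move=> [[|[|[|?]]] ?] //; apply/val_inj. Qed.

Fact right_opx1 : right_id ord0 (table_op right_table).
Proof. by move=> [[|[|[|?]]] ?] //; apply/val_inj. Qed.

Definition left_monoid : nvmonoid 1 'I_3 :=
  single_valued left_opA left_op1x left_opx1.

Definition right_monoid : nvmonoid 1 'I_3 :=
  single_valued right_opA right_op1x right_opx1.

(* The bijection 0 |-> e, 1 |-> x1, 2 |-> x2.                                  *)
Definition label (X : Type) (e x1 x2 : X) (i : 'I_3) : X :=
  nth e [:: e; x1; x2] i.

Local Open Scope ring_scope.

Definition mx43 (rows : seq (seq rat)) : 'M[rat]_(4, 3) :=
  \matrix_(i < 4, j < 3) nth 0 (nth [::] rows i) j.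

Definition nvmatrix n (X : choiceType) (M : nvmonoid n X) (x1 x2 : X)
    : 'M[rat]_(4, 3) :=
  let row x y :=
    [:: (nvmult M x y (nvunit M))%:R; (nvmult M x y x1)%:R;
        (nvmult M x y x2)%:R] in
  mx43 [:: row x1 x1; row x1 x2; row x2 x1; row x2 x2].

Definition B1 (n a0 c0 : rat) : 'M[rat]_(4, 3) :=
  mx43 [:: [:: a0; n - a0;      0];
           [:: 0;  0;           n];
           [:: 0;  0;           n];
           [:: c0; c0 * n / a0; n - c0 - c0 * n / a0]].

Definition B2 (n a0 a1 b0 b1 : rat) : 'M[rat]_(4, 3) :=
  mx43 [:: [:: a0; a1; n - a0 - a1];
           [:: b0; b1; n - b0 - b1];
           [:: b0; b1; n - b0 - b1];
           [:: (b0 * (n - b0 - b1) + a0 * b1 - a1 * b0) / (n - a0 - a1);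
               ((b0 + b1) * (n - b1)) / (n - a0 - a1);
               ((n - b0 - b1) ^+ 2 + n * (b1 - a0 - a1) + a1 * b0 - a0 * b1)
                 / (n - a0 - a1)]].

Definition B3 (n c0 c1 : rat) : 'M[rat]_(4, 3) :=
  mx43 [:: [:: 0;  n;  0];
           [:: 0;  n;  0];
           [:: 0;  n;  0];
           [:: c0; c1; n - c0 - c1]].

Definition B4 (n c1 : rat) : 'M[rat]_(4, 3) :=
  mx43 [:: [:: 0; n;  0];
           [:: 0; 0;  n];
           [:: 0; 0;  n];
           [:: 0; c1; n - c1]].

(* Entries of nvmatrix are natural numbers, so the equations below force all   *)
(* entries of the B_j, and hence the parameters, to be non-negative integers.  *)
Definition in_B1 n (X : choiceType) (M : nvmonoid n X) (x1 x2 : X) : Prop :=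
  exists a0 c0 : rat, a0 != 0 /\ nvmatrix M x1 x2 = B1 n%:R a0 c0.

Definition in_B2 n (X : choiceType) (M : nvmonoid n X) (x1 x2 : X) : Prop :=
  exists a0 a1 b0 b1 : rat,
    n%:R - a0 - a1 != 0 /\ nvmatrix M x1 x2 = B2 n%:R a0 a1 b0 b1.

Definition in_B3 n (X : choiceType) (M : nvmonoid n X) (x1 x2 : X) : Prop :=
  exists c0 c1 : rat, nvmatrix M x1 x2 = B3 n%:R c0 c1.

Definition in_B4 n (X : choiceType) (M : nvmonoid n X) (x1 x2 : X) : Prop :=
  exists c1 : rat, nvmatrix M x1 x2 = B4 n%:R c1.

(* Main.v *)
Require Import Defs.
From mathcomp Require Import all_boot all_order all_algebra.
From mathcomp Require Import finmap multiset.
From mathcomp Require Import zify ring lra.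

Set Implicit Arguments.
Unset Strict Implicit.
Unset Printing Implicit Defensive.

Import Order.TTheory GRing.Theory Num.Theory.

Local Open Scope mset_scope.
Local Open Scope nat_scope.

(** Write m s t u for the multiplicity of u in s * t.  These numbers are the
    structure constants of an algebra with basis e, x, y in which e acts as
    multiplication by n, and every row of them sums to n.  Two observations
    decide everything.

    If y occurs in x * x then, up to scaling, y is a polynomial in x, so the
    algebra is commutative ([nvmult_commute]); moreover solving
    x * (x * y) = (x * x) * y for y * y gives the series B2.

    If y does not occur in x * x then the coefficient of x in the same law is an
    equation in which a sum of two products of natural numbers is zero, and this
    forces x * y to be n times x or n times y ([nvmult_split]).

    In the commutative case the remaining freedom is fixed by the unit
    coefficients of associativity, giving B1, B3 and B4
    ([commutative_series]).  In the noncommutative case the second observation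
    holds with x and y exchanged as well, so one of x * y, y * x is n x and the
    other is n y; the law (x * y) * x = x * (y * x) then gives x * x = n x, and
    likewise y * y = n y ([noncommutative_products]).  These are the
    n-fold diagonals of the two tables.  There no product x * t contains e, so x
    has no inverse and groups of order 3 are commutative. *)

(** * Structure constants *)

Lemma sum_mset_seq (X : choiceType) (A : {mset X}) (s : seq X) (F : X -> nat) :
  uniq s -> (forall t, t \in s) ->
  \sum_(w <- A) F w = \sum_(t <- s) A t * F t.
Proof.
move=> s_uniq s_full; rewrite sum_mset [RHS](bigID (mem (finsupp A))) /=.
rewrite [X in _ = _ + X]big1 => [|t]; last by rewrite memNfinsupp => /eqP->.
rewrite addn0 -[RHS]big_filter; apply/perm_big/uniq_perm.
- exact: fset_uniq.
- exact: filter_uniq.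
- by move=> t; rewrite mem_filter s_full andbT.
Qed.

Lemma nvcommutativeP n (X : choiceType) (M : nvmonoid n X) :
  (forall x y z, nvmult M x y z = nvmult M y x z) -> nvcommutative M.
Proof. by move=> MC x y; apply/val_inj/msetP => z; apply: MC. Qed.

(** * Order three: products of the two non-unit elements *)

Section OrderThree.

Variables (n : nat) (X : finType) (M : nvmonoid n X).
Hypotheses (n_gt0 : 0 < n) (X3 : #|X| = 3).

Local Notation e := (nvunit M).
Local Notation m := (nvmult M).
Local Notation only z := (fun u => if u == z then n else 0).

Lemma nvmult1x x u : m e x u = if u == x then n else 0.
Proof. by rewrite /nvmult nvmul1x msetnE. Qed.

Lemma nvmultx1 x u : m x e u = if u == x then n else 0.
Proof. by rewrite /nvmult nvmulx1 msetnE. Qed.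

Section Frame.

Variables x y : X.
Hypothesis exy : uniq [:: e; x; y].

Lemma frame_full t : t \in [:: e; x; y].
Proof.
have le3 : size (enum X) <= size [:: e; x; y] by rewrite -cardE X3.
have [_ ->] := uniq_min_size exy (fun z _ => mem_enum X z) le3.
by rewrite mem_enum.
Qed.

Lemma frame_eqE :
  ((e == x) = false) * ((x == e) = false) * ((e == y) = false)
  * ((y == e) = false) * ((x == y) = false) * ((y == x) = false).
Proof.
move: exy; rewrite /= !inE negb_or andbT => /andP[/andP[ex ey] xy].
by rewrite !(eq_sym y) (eq_sym x e) !(negPf ex, negPf ey, negPf xy).
Qed.

Lemma nvmult_total s t : m s t e + m s t x + m s t y = n.
Proof.
have := eqP (sym_mset_size (nvmul M s t)).
rewrite -sum1_size (sum_mset_seq _ _ exy frame_full) !big_cons big_nil.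
by rewrite !muln1 addn0 addnA.
Qed.

(** Both sides of r * (s * t) = (r * s) * t are sums over w = e, x, y; in the
    term w = e the remaining factor is a product by the unit, which is known. *)
Lemma nvmult_assoc r s t u :
    m s t e * (if u == r then n else 0) + m s t x * m r x u + m s t y * m r y u
  = m r s e * (if u == t then n else 0) + m r s x * m x t u + m r s y * m y t u.
Proof.
have /msetP/(_ u) := nvmulA M r s t.
rewrite !bigmsetDE !(sum_mset_seq _ _ exy frame_full) !big_cons !big_nil.
by rewrite !addn0 !addnA -/(m r e u) -/(m e t u) nvmultx1 nvmult1x.
Qed.

(** When [y] occurs in x * x, the element y is, in the algebra of multisets, a
    linear combination of e, x and the power x * x, all of which commute
    with x.  In coordinates: x * (x * x) = (x * x) * x, where all terms cancel
    but the one in which y is multiplied by x. *)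
Lemma nvmult_commute : m x x y != 0 -> m x y =1 m y x.
Proof.
rewrite -lt0n => xxy_gt0 u; have /addnI/eqP := nvmult_assoc x x x u.
by rewrite eqn_pmul2l // => /eqP.
Qed.

(** The coefficient of [x] in x * (x * y) = (x * x) * y.  Let a and b be the
    multiplicities of x * x and x * y.  As a_y = 0, the law reads
    n * b_e + b_x * a_x + b_y * b_x = a_x * b_x, hence n * b_e + b_y * b_x = 0.
    These are natural numbers, so b_e = 0 and one of b_x, b_y vanishes. *)
Lemma nvmult_split : m x x y = 0 ->
  m x y =1 only x \/ m x y =1 only y.
Proof.
have tot := nvmult_total x y; move=> a0; have /eqP := nvmult_assoc x x y x.
rewrite eqxx frame_eqE a0 muln0 add0n mul0n addn0 (mulnC (m x x x)) addnAC.
rewrite -[X in _ == X]add0n eqn_add2r addn_eq0 !muln_eq0 (gtn_eqF n_gt0) orbF.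
case/andP=> /eqP b0 /orP[] /eqP b; [left | right] => u;
  move: (frame_full u); rewrite !inE => /or3P[] /eqP->;
  rewrite ?eqxx ?frame_eqE /=; lia.
Qed.

(** Compare (x * y) * x with x * (y * x): in each case one side is n times x * x
    and the other is n * n times x.  The hypothesis is stable under exchanging
    x and y, so the same lemma yields y * y. *)
Lemma nvmult_square :
    (m x y =1 only x /\ m y x =1 only y) \/
    (m x y =1 only y /\ m y x =1 only x) ->
  m x x =1 only x.
Proof.
move=> H u; move: H (nvmult_assoc x y x u).
case=> -[xyE yxE]; rewrite !xyE !yxE !eqxx !frame_eqE !mul0n ?add0n ?addn0;
by move=> /eqP; rewrite eqn_pmul2l // => /eqP->.
Qed.

Lemma frame_commutative : m x y =1 m y x -> nvcommutative M.
Proof.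
move=> xyC; apply: nvcommutativeP => s t u.
have [-> | s_ne] := eqVneq s e; first by rewrite nvmult1x nvmultx1.
have [-> | t_ne] := eqVneq t e; first by rewrite nvmult1x nvmultx1.
move: (frame_full s) (frame_full t); rewrite !inE (negPf s_ne) (negPf t_ne) /=.
by case/orP=> /eqP-> /orP[] /eqP->.
Qed.

End Frame.

(** * The noncommutative case *)

(** Neither square can involve the other element, by [nvmult_commute], so
    [nvmult_split] applies to both x * y and y * x; of the four outcomes the two
    in which these products agree are commutative. *)
Lemma noncommutative_products x y :
    uniq [:: e; x; y] -> ~ nvcommutative M ->
  [/\ m x x =1 only x,
      m y y =1 only y &
    (m x y =1 only x /\ m y x =1 only y) \/
    (m x y =1 only y /\ m y x =1 only x)].
Proof.
move=> exy MnC.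
have eyx : uniq [:: e; y; x].
  rewrite (@perm_uniq _ _ [:: e; x; y]) // perm_cons.
  exact/permPl/(perm_catC [:: y] [:: x]).
have xxy0 : m x x y = 0.
  apply/eqP/idPn => /(nvmult_commute exy) C.
  exact/MnC/(frame_commutative exy C).
have yyx0 : m y y x = 0.
  apply/eqP/idPn => /(nvmult_commute eyx) C.
  exact/MnC/(frame_commutative eyx C).
have prods :
    (m x y =1 only x /\ m y x =1 only y) \/
    (m x y =1 only y /\ m y x =1 only x).
  have [xyE|xyE] := nvmult_split exy xxy0;
    have [yxE|yxE] := nvmult_split eyx yyx0; [by left | | | by right];
    by case: MnC; apply: (frame_commutative exy) => u; rewrite xyE yxE.
split=> //; first exact: nvmult_square exy prods.
by apply: (nvmult_square eyx); case: prods => -[]; [left | right].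
Qed.

(** This is what prevents x from having an inverse. *)
Lemma noncommutative_unitN x y v :
  uniq [:: e; x; y] -> ~ nvcommutative M -> m x v e = 0.
Proof.
move=> exy MnC; have [xxE _ prods] := noncommutative_products exy MnC.
move: (frame_full exy v); rewrite !inE => /or3P[] /eqP->.
- by rewrite nvmultx1 (frame_eqE exy).
- by rewrite xxE (frame_eqE exy).
- by case: prods => -[-> _]; rewrite (frame_eqE exy).
Qed.

Lemma frame_exists : exists x y, uniq [:: e; x; y].
Proof.
have : size (rem e (enum X)) = 2 by rewrite size_rem ?mem_enum // -cardE X3.
case Es: (rem e (enum X)) => [|x [|y [|]]] // _; exists x, y.
by rewrite -Es -(perm_uniq (perm_to_rem (mem_enum X e))) enum_uniq.
Qed.

Lemma label_bij x y : uniq [:: e; x; y] -> bijective (label e x y).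
Proof.
move=> exy; apply: inj_card_bij; last by rewrite X3 card_ord.
by move=> i j /(uniqP e exy) => /(_ (ltn_ord i) (ltn_ord j))/val_inj.
Qed.

Lemma noncommutative_diagonal x y :
    uniq [:: e; x; y] -> ~ nvcommutative M ->
  diagonal_via M left_monoid (label e x y) \/
  diagonal_via M right_monoid (label e x y).
Proof.
move=> exy MnC; have [xxE yyE prods] := noncommutative_products exy MnC.
case: prods => -[xyE yxE]; [left | right]; split=> //; try exact: label_bij.
all: exists n; rewrite ?muln1 // => i j k.
all: rewrite /nvmult /= mset_scaleE msetnE -/(m _ _ _).
all: case: i j k => [[|[|[|?]]] ?] [[|[|[|?]]] ?] [[|[|[|?]]] ?] //;
  rewrite /label /= ?nvmult1x ?nvmultx1 ?xxE ?yyE ?xyE ?yxE;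
  by rewrite ?eqxx ?(frame_eqE exy) /= ?muln1 ?muln0.
Qed.

(** * The commutative case *)

(** Solve x * (x * y) = (x * x) * y for the unknown products.  If [y] occurs in
    x * x, with multiplicity a_y, this law expresses a_y times y * y through
    x * x and x * y, which is [B2].  Otherwise x * y is n times x or n times y
    by [nvmult_split].  In the first case the unit coefficient of the same law
    gives x * x = n x, which is [B3].  In the second case the unit coefficient
    of x * (y * y) = (x * y) * y reads c_x * a_e = n * c_e, where a and c are
    the multiplicities of x * x and y * y; this is [B1] or, when a_e = 0,
    [B4]. *)
Lemma commutative_series x y :
    uniq [:: e; x; y] -> nvcommutative M ->
  [\/ in_B1 M x y, in_B2 M x y, in_B3 M x y | in_B4 M x y].
Proof.
move=> exy MC; have yxE : m y x =1 m x y by move=> u; rewrite /nvmult MC.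
have rowE s t : (n%:R = (m s t e)%:R + (m s t x)%:R + (m s t y)%:R :> rat)%R.
  by rewrite -!natrD nvmult_total.
have axy u := nvmult_assoc exy x x y u; have ayy u := nvmult_assoc exy x y y u.
have [xxy0 | xxy_neq0] := eqVneq (m x x y) 0; last first.
  constructor 2; exists (m x x e)%:R%R, (m x x x)%:R%R.
  exists (m x y e)%:R%R, (m x y x)%:R%R.
  have aE : (n%:R - (m x x e)%:R - (m x x x)%:R = (m x x y)%:R :> rat)%R.
    by rewrite (rowE x x); ring.
  have bE : (n%:R - (m x y e)%:R - (m x y x)%:R = (m x y y)%:R :> rat)%R.
    by rewrite (rowE x y); ring.
  have nz : ((m x x y)%:R != 0 :> rat)%R by rewrite pnatr_eq0.
  rewrite /B2 aE bE; split=> //; congr (mx43 [:: _; _; _; _]).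
  - by rewrite !yxE.
  - have ratE u := congr1 (fun k => k%:R%R : rat) (axy u).
    move: (ratE e) (ratE x) (ratE y) (rowE x x) (rowE x y).
    rewrite !eqxx !(frame_eqE exy) !natrD !natrM => Ee Ex Ey xxE xyE.
    (* The formulas of B2 also contain products of n with b_x and a_x, to be
       expanded with n as a row sum before the identities become linear. *)
    have nb1 := congr1 (fun c => c * (m x y x)%:R)%R xxE.
    have na1 := congr1 (fun c => c * (m x x x)%:R)%R xyE.
    have nb1' := congr1 (fun c => c * (m x y x)%:R)%R xyE.
    by congr [:: _; _; _]; apply: (canRL (mulfK nz)); lra.
have xxE : (m x x x)%:R%R = (n%:R - (m x x e)%:R)%R :> rat.
  by rewrite (rowE x x) xxy0; ring.
have yyE : (m y y y)%:R%R = (n%:R - (m y y e)%:R - (m y y x)%:R)%R :> rat.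
  by rewrite (rowE y y); ring.
rewrite /in_B1 /in_B3 /in_B4 /nvmatrix !yxE !yyE xxy0 !xxE.
have [xyE | xyE] := nvmult_split exy xxy0; rewrite !xyE ?eqxx !(frame_eqE exy).
  constructor 3; exists (m y y e)%:R%R, (m y y x)%:R%R.
  have xxe0 : m x x e = 0.
    by have := axy e; rewrite !xyE xxy0 eqxx !(frame_eqE exy); nia.
  by rewrite xxe0 subr0.
have yye : m y y x * m x x e = n * m y y e.
  by have := ayy e; rewrite !xyE !eqxx !(frame_eqE exy) !muln0 addn0.
have [xxe0 | xxe_neq0] := eqVneq (m x x e) 0.
  constructor 4; exists (m y y x)%:R%R.
  have yye0 : m y y e = 0 by nia.
  by rewrite xxe0 yye0 !subr0.
constructor 1; exists (m x x e)%:R%R, (m y y e)%:R%R.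
have nz : ((m x x e)%:R != 0 :> rat)%R by rewrite pnatr_eq0.
suff -> : ((m y y x)%:R = (m y y e)%:R * n%:R / (m x x e)%:R :> rat)%R by [].
by apply: (canRL (mulfK nz)); rewrite -!natrM yye mulnC.
Qed.

End OrderThree.

(** * Groups, and isomorphism classes *)

Lemma nvgroup_commutative n (X : finType) (G : nvgroup n X) :
  0 < n -> #|X| = 3 -> nvcommutative G.
Proof.
move=> n_gt0 X3; have [x [y exy]] := frame_exists G X3.
have [xyC | xyNC] := boolP (nvmul G x y == nvmul G y x).
  by apply: (frame_commutative X3 exy) => u; rewrite /nvmult (eqP xyC).
have := nvmulxV G x; rewrite in_mset -/(nvmult G _ _ _).
rewrite (noncommutative_unitN n_gt0 X3 _ exy) // => GC.
by rewrite GC eqxx in xyNC.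
Qed.

Lemma diagonal_via_isom n (X Y : choiceType) (M : nvmonoid n X) k
    (N : nvmonoid k Y) (f : Y -> X) :
  0 < n -> diagonal_via M N f -> nvisom M N.
Proof.
move=> n_gt0 [[g fK gK] f1 [l n_lk fM]]; exists g; split.
- by exists f.
- by rewrite -f1 fK.
move=> s t u; rewrite -{1}(gK s) -{1}(gK t) -{1}(gK u) fM.
rewrite {1}/nvmult /= mset_scaleE -/(nvmult N _ _ _) n_lk.
move: n_gt0; rewrite n_lk muln_gt0 => /andP[l_gt0 k_gt0].
have l_neq0 : (l%:R != 0 :> rat)%R by rewrite pnatr_eq0 -lt0n.
have k_neq0 : (k%:R != 0 :> rat)%R by rewrite pnatr_eq0 -lt0n.
rewrite -!pmulrn !natrM; by field; rewrite k_neq0 l_neq0.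
Qed.

Lemma single_valuedE (X : choiceType) (op : X -> X -> X) (e : X)
    (opA : associative op) (op1x : left_id e op) (opx1 : right_id e op) x y z :
  nvmult (single_valued opA op1x opx1) x y z = (z == op x y).
Proof. by rewrite /nvmult /= msetnE; case: eqP. Qed.

Lemma left_monoid_noncommutative : ~ nvcommutative left_monoid.
Proof.
move=> /(_ 1%R 2%R) /(congr1 (fun A : Symn 1 _ => (A : {mset 'I_3}) 1%R)).
by rewrite -!/(nvmult _ _ _ _) !single_valuedE.
Qed.

Lemma right_monoid_noncommutative : ~ nvcommutative right_monoid.
Proof.
move=> /(_ 1%R 2%R) /(congr1 (fun A : Symn 1 _ => (A : {mset 'I_3}) 1%R)).
by rewrite -!/(nvmult _ _ _ _) !single_valuedE.
Qed.

(** An isomorphism sends 1 and 2 to distinct non-unit elements; a product of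
    such elements is its left factor in one monoid and its right factor in the
    other. *)
Lemma left_right_nonisom : ~ nvisom left_monoid right_monoid.
Proof.
case=> phi [/bij_inj phi_inj phi0 phiM].
have := phiM 1%R 2%R 1%R; rewrite !single_valuedE !divr1 /=.
have : phi 1%R != phi ord0 by rewrite (inj_eq phi_inj).
have : phi 2%R != phi ord0 by rewrite (inj_eq phi_inj).
have : phi 1%R != phi 2%R by rewrite (inj_eq phi_inj).
rewrite phi0.
by case: (phi 1%R) (phi 2%R) => [[|[|[|?]]] ?] [[|[|[|?]]] ?].
Qed.

Theorem corollary3 :
  [/\ forall (n : nat) (X : finType) (M : nvmonoid n X) (x1 x2 : X),
        (1 <= n)%N -> #|X| = 3 -> uniq [:: nvunit M; x1; x2] ->
        nvcommutative M ->
        [\/ in_B1 M x1 x2, in_B2 M x1 x2, in_B3 M x1 x2 | in_B4 M x1 x2],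
      forall (n : nat) (X : finType) (M : nvmonoid n X) (x1 x2 : X),
        (1 <= n)%N -> #|X| = 3 -> uniq [:: nvunit M; x1; x2] ->
        ~ nvcommutative M ->
        diagonal_via M left_monoid (label (nvunit M) x1 x2)
        \/ diagonal_via M right_monoid (label (nvunit M) x1 x2),
      forall (n : nat) (X : finType) (G : nvgroup n X),
        (1 <= n)%N -> #|X| = 3 -> nvcommutative G
    & [/\ ~ nvcommutative left_monoid,
          ~ nvcommutative right_monoid,
          ~ nvisom left_monoid right_monoid
        & forall (n : nat) (X : finType) (M : nvmonoid n X),
            (1 <= n)%N -> #|X| = 3 -> ~ nvcommutative M ->
            nvisom M left_monoid \/ nvisom M right_monoid]].
Proof.
split.
- by move=> n X M x1 x2 n_gt0 X3; apply: commutative_series.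
- by move=> n X M x1 x2 n_gt0 X3; apply: noncommutative_diagonal.
- by move=> n X G n_gt0 X3; apply: nvgroup_commutative.
split.
- exact: left_monoid_noncommutative.
- exact: right_monoid_noncommutative.
- exact: left_right_nonisom.
move=> n X M n_gt0 X3 MnC; have [x1 [x2 ex]] := frame_exists M X3.
by have [] := noncommutative_diagonal n_gt0 X3 ex MnC;
  move/(diagonal_via_isom n_gt0); [left | right].
Qed.
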